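(* Let $G$ be a finite group and $N$ a normal subgroup of $G$. If $\alpha(G)=\alpha(G/N)$, then $N$ is an elementary abelian $2$-group.
   Context: For a finite group $H$, $c(H)$ denotes the number of cyclic subgroups of $H$ (including the trivial one) and $\alpha(H):=c(H)/|H|$. The trivial group is regarded as an elementary abelian $2$-group. *)

(* Defs.v *)
From HB Require Import structures.
From mathcomp Require Import all_boot all_order all_algebra.
From mathcomp Require Import all_fingroup all_solvable.

Set Implicit Arguments.
Unset Strict Implicit.
Unset Printing Implicit Defensive.

Import GRing.Theory Num.Theory.

Local Open Scope ring_scope.

Definition num_cyclic_subgroups (gT : finGroupType) (H : {group gT}) : nat :=
  #|[set C in subgroups H | cyclic C]|.

Definition cyclic_ratio (gT : finGroupType) (H : {group gT}) : rat :=
  (num_cyclic_subgroups H)%:R / #|H|%:R.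

(* Main.v *)
Require Import Defs.
From mathcomp Require Import all_boot all_order all_algebra.
From mathcomp Require Import all_fingroup all_solvable.

(** A cyclic group of order d has totient d generators, so letting each cyclic
    subgroup of G share out a weight of 1 equally among its generators gives
    c(G) = \sum_(x in G) 1 / totient #[x]  (num_cyclic_subgroupsE).
    Counting c(G / N) in the same way and pulling the sum back along the
    #|N|-to-one projection G -> G / N gives
    #|N| * c(G / N) = \sum_(x in G) 1 / totient #[coset N x]  (sum_coset).
    As #[coset N x] divides #[x] and the totient is monotone for divisibility
    (leq_totient_dvd), the first sum is bounded by the second term by term.
    The hypothesis c(G) / #|G| = c(G / N) / #|G / N| says that the two sums are
    equal, so they agree term by term.  An x in N has trivial coset, hence
    totient #[x] = 1, that is #[x] <= 2, and a group of exponent dividing 2 is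
    elementary abelian. *)

Import GRing.Theory Num.Theory.

Local Open Scope ring_scope.

(** The p-part and the p'-part of the totient can be bounded separately, since
    the totient is multiplicative: the former by its value on prime powers, the
    latter by induction, as the p'-part of n is smaller than n. *)
Lemma leq_totient_dvd (d n : nat) :
  (0 < n)%N -> (d %| n)%N -> (totient d <= totient n)%N.
Proof.
elim/ltn_ind: n d => n IHn d n_gt0 dvd_dn.
have [n_le1 | n_gt1] := leqP n 1.
  have n1: n = 1%N by apply/eqP; rewrite eqn_leq n_le1.
  by move: dvd_dn; rewrite n1 dvdn1 => /eqP->.
have d_gt0 := dvdn_gt0 n_gt0 dvd_dn.
pose p := pdiv n; have p_pr : prime p by apply: pdiv_prime.
have logn_gt0 : (0 < logn p n)%N by rewrite logn_gt0 pi_pdiv.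
rewrite -(partnC p d_gt0) -(partnC p n_gt0).
rewrite !totient_coprime ?coprime_partC //.
apply: leq_mul; last first.
  apply: IHn; rewrite ?part_gt0 ?partn_dvd //.
  rewrite -[X in (_ < X)%N](partnC p n_gt0) ltn_Pmull ?part_gt0 //.
  by rewrite p_part -(expn0 p) ltn_exp2l ?prime_gt1.
rewrite !p_part (totient_pfactor p_pr logn_gt0).
have le_log : (logn p d <= logn p n)%N by apply: dvdn_leq_log.
have [-> | log_d_gt0] := posnP (logn p d).
  rewrite expn0 muln_gt0 expn_gt0 (prime_gt0 p_pr) andbT.
  by rewrite -subn1 subn_gt0 prime_gt1.
rewrite (totient_pfactor p_pr log_d_gt0) leq_mul2l.
by rewrite leq_exp2l ?prime_gt1 // -!subn1 leq_sub2r ?orbT.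
Qed.

Lemma num_cyclic_subgroups_imset (gT : finGroupType) (G : {group gT}) :
  num_cyclic_subgroups G = #|[set <[x]>%g | x in G]|.
Proof.
rewrite /num_cyclic_subgroups -(card_imset _ (@group_inj gT)).
apply: eq_card => C; apply/imsetP/imsetP => [[H] | [x Gx ->]].
  rewrite !inE => /andP[sHG /cyclicP[x defH]] ->.
  by exists x; rewrite -?cycle_subG -?defH.
by exists <[x]>%G; rewrite // !inE cycle_subG Gx cycle_cyclic.
Qed.

Lemma num_cyclic_subgroupsE (gT : finGroupType) (G : {group gT}) :
  (num_cyclic_subgroups G)%:R = \sum_(x in G) (totient #[x]%g)%:R^-1 :> rat.
Proof.
rewrite num_cyclic_subgroups_imset -sum1_card natr_sum.
rewrite (partition_big_imset (fun x : gT => <[x]>%g)) /=.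
apply: eq_bigr => _ /imsetP[x Gx ->].
(* The elements of G with cyclic subgroup <[x]> are the generators of <[x]>. *)
rewrite (eq_bigr (fun=> (totient #[x]%g)%:R^-1)) => [|y /andP[_ /eqP eq_yx]].
  rewrite sumr_const -[RHS]mulr_natl totient_gen.
  rewrite (_ : #|_| = #|[set y | generator <[x]> y]|).
    by rewrite divff // -totient_gen pnatr_eq0 -lt0n totient_gt0 order_gt0.
  apply: eq_card => y; rewrite !inE /generator eq_sym unfold_in.
  rewrite -cycle_subG.
  by case: eqP => [-> | _]; rewrite ?cycle_subG ?Gx ?andbF.
by rewrite /order eq_yx.
Qed.

(** The fibre of the projection over coset N x is the right coset of x, which
    has #|N| elements and lies in G because N does. *)
Lemma sum_coset (gT : finGroupType) (G N : {group gT}) (R : pzSemiRingType)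
    (F : coset_of N -> R) :
  (N <| G)%g ->
  \sum_(x in G) F (coset N x) = #|N|%:R * \sum_(y in (G / N)%g) F y.
Proof.
move=> /andP[sNG nNG]; rewrite mulr_sumr.
rewrite (partition_big_imset (coset N)) -(morphimEsub (coset_morphism N) nNG).
apply: eq_bigr => _ /morphimP[x Nx Gx ->].
rewrite -(card_rcoset _ x) mulr_natl -sumr_const.
apply: eq_big => [z | z /andP[_ /eqP ->]] //.
have [Gz | G'z] := boolP (z \in G).
  by rewrite (sameP eqP (rcoset_kercosetP _ _)) ?(subsetP nNG).
by case: rcosetP G'z => // -[t Nt ->]; rewrite groupM // (subsetP sNG).
Qed.

(** Multiplying by #|G| rather than #|G / N| turns the ratio of the quotient into
    a sum over G, to be compared term by term with that of num_cyclic_subgroupsE. *)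
Lemma card_quotient_ratio (gT : finGroupType) (G N : {group gT}) :
  (N <| G)%g ->
  #|G|%:R * cyclic_ratio (G / N)%G =
    \sum_(x in G) (totient #[coset N x]%g)%:R^-1.
Proof.
move=> nsNG; rewrite (@sum_coset _ _ _ _ (fun y => (totient #[y]%g)%:R^-1)) //.
rewrite -num_cyclic_subgroupsE /cyclic_ratio.
rewrite -(Lagrange (normal_sub nsNG)) natrM -card_quotient ?normal_norm //.
by rewrite -mulrA [_%:R * (_ / _)]mulrC divfK // pnatr_eq0 -lt0n cardG_gt0.
Qed.

Local Close Scope ring_scope.

Theorem mainTheorem16 (gT : finGroupType) (G N : {group gT})
    (nNG : (N <| G)%g)
    (eq_ratio : cyclic_ratio G = cyclic_ratio (G / N)%G) :
  (2.-abelem N)%g.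
Proof.
have [sNG nNG'] := andP nNG.
pose w (m : nat) : rat := ((totient m)%:R^-1)%R.
have w_le x : x \in G -> (w #[x]%g <= w #[coset N x]%g)%R.
  move=> Gx; rewrite lef_pV2 ?posrE ?ltr0n ?totient_gt0 ?order_gt0 // ler_nat.
  by rewrite leq_totient_dvd ?order_gt0 ?morph_order ?(subsetP nNG').
have eq_sum : (\sum_(x in G) (w #[coset N x]%g - w #[x]%g) = 0)%R.
  rewrite sumrB -card_quotient_ratio // -eq_ratio -num_cyclic_subgroupsE.
  by rewrite /cyclic_ratio mulrC divfK ?subrr // pnatr_eq0 -lt0n cardG_gt0.
apply: exponent2_abelem; apply/exponentP => x Nx.
have Gx := subsetP sNG x Nx.
have /eqP : (w #[coset N x]%g - w #[x]%g = 0)%R.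
  by apply: (psumr_eq0P _ eq_sum) => // y Gy; rewrite subr_ge0 w_le.
rewrite coset_id // order1 subr_eq0 (inj_eq invr_inj) eqr_nat => /eqP tot_x.
have ox_le2 : #[x]%g <= 2 by rewrite leqNgt -totient_gt1 -tot_x.
apply/eqP; rewrite -order_dvdn.
by case: #[x]%g (order_gt0 x) ox_le2 => [|[|[|]]].
Qed.
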